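(* Let $p\in K(\beta\mathbb{N},+)$. Then $\mathbb{N}^*\setminus\{p\}$ is not normal.
   Context: $\mathbb{N}=\{1,2,3,\dots\}$ is discrete. $\beta\mathbb{N}$ is the set of ultrafilters on $\mathbb{N}$ (principal ultrafilters identified with points of $\mathbb{N}$), with the topology whose basic clopen sets are $\overline{A}=\{p\in\beta\mathbb{N}: A\in p\}$, $A\subseteq\mathbb{N}$; $\mathbb{N}^*=\beta\mathbb{N}\setminus\mathbb{N}$ with the subspace topology. Addition extends to $\beta\mathbb{N}$ by: $A\in p+q$ iff $\{x\in\mathbb{N}: -x+A\in q\}\in p$, where $-x+A=\{y\in\mathbb{N}: x+y\in A\}$. This makes $(\beta\mathbb{N},+)$ a compact Hausdorff right topological semigroup, and $K(\beta\mathbb{N},+)$ is its smallest two-sided ideal. *)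

(* Defs.v *)
From HB Require Import structures.
From mathcomp Require Import all_boot.
From mathcomp Require Import all_classical topology.

Set Implicit Arguments.
Unset Strict Implicit.
Unset Printing Implicit Defensive.

Local Open Scope classical_set_scope.

Definition posnat := {n : nat | (0 < n)%N}.

Definition posnat_add (x y : posnat) : posnat :=
  exist (fun n => 0 < n)%N (val x + val y)%N
    (ltn_addr (val y) (valP x)).

Record betaN := BetaN {
  ultra_sets :> set posnat -> Prop;
  ultra_setsP : UltraFilter ultra_sets
}.

#[global] Existing Instance ultra_setsP.

Lemma betaN_ext (p q : betaN) : (forall A, p A <-> q A) -> p = q.
Proof.
case: p q => [F hF] [G hG] /= FG.
have E : F = G by apply/funext => A; apply/propext; exact: FG.
by rewrite E in hF *; congr BetaN; exact: Prop_irrelevance.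
Qed.

HB.instance Definition _ := gen_eqMixin betaN.
HB.instance Definition _ := gen_choiceMixin betaN.

Definition beta_bar (A : set posnat) : set betaN := [set p : betaN | p A].

Lemma beta_bar_cover : \bigcup_(A in [set: set posnat]) beta_bar A = [set: betaN].
Proof. by apply/seteqP; split => // p _; exists setT => //; exact: filterT. Qed.

Lemma beta_bar_join (A B : set posnat) (p : betaN) :
  [set: set posnat] A -> [set: set posnat] B -> beta_bar A p -> beta_bar B p ->
  exists C, [/\ [set: set posnat] C, beta_bar C p &
                beta_bar C `<=` beta_bar A `&` beta_bar B].
Proof.
move=> _ _ pA pB; exists (A `&` B); split => //; first exact: filterI.
by move=> q qAB; split; apply: filterS qAB => x [].
Qed.

HB.instance Definition _ :=
  isBaseTopological.Build betaN beta_bar_cover beta_bar_join.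

Definition beta_point (n : posnat) : betaN :=
  BetaN (principal_filter_ultra n).

Definition Nstar : set betaN := ~` range beta_point.

(* Right topological convention: p + q is continuous in p. *)
Definition beta_add_sets (p q : betaN) : set_system posnat :=
  [set A | p [set x | q [set y | A (posnat_add x y)]]].

Lemma beta_add_ultra (p q : betaN) : UltraFilter (beta_add_sets p q).
Proof.
have F_filter : Filter (beta_add_sets p q).
  split.
  - by apply: (@filterE _ p) => x; exact: filterT.
  - by move=> A B pA pB; apply: (@filterS2 _ p) pA pB => x; exact: filterI.
  - by move=> A B AB; apply: (@filterS _ p) => x; apply: filterS => y; exact: AB.
have FF : ProperFilter (beta_add_sets p q).
  apply: (@Build_ProperFilter_ex _ _ _ F_filter) => A.
  by move=> /(@filter_ex _ p _)[x /(@filter_ex _ q _)[y Axy]]; exists (posnat_add x y).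
split=> // G GF FG; apply/seteqP; split=> // A GA.
have [//|pnA] := in_ultra_setVsetC [set x | q [set y | A (posnat_add x y)]]
  (ultra_setsP p).
suff /FG GnA : beta_add_sets p q (~` A).
  have GAnA : G (A `&` ~` A) by exact: filterI.
  by have [x []] := filter_ex GAnA.
apply: (@filterS _ p) pnA => x /= nqA.
by have [] := in_ultra_setVsetC [set y | A (posnat_add x y)] (ultra_setsP q).
Qed.

Definition beta_add (p q : betaN) : betaN := BetaN (beta_add_ultra p q).

Definition two_sided_ideal (I : set betaN) : Prop :=
  I !=set0 /\ forall p q, I p -> I (beta_add p q) /\ I (beta_add q p).

(* K(betaN, +): [smallest C set0] is the intersection of all sets satisfying C. *)
Definition K_betaN : set betaN := smallest two_sided_ideal set0.

(* Main.v *)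
Require Import Defs.
From mathcomp Require Import all_boot zify.
From mathcomp Require Import all_classical topology.

(** The point [p] lies in a minimal left ideal, which contains an idempotent [e]
    (lemmas [K_minl] and [minl_idempotent]); the ideal is the set [L] of all [q]
    with [q + e = q], the right translation [q |-> q + e] is a continuous
    retraction onto [L], and it fixes [p]. Let [A] be the fibre of this
    retraction over [p], taken among nonprincipal ultrafilters. Then [A] and
    [L] are closed and meet only in [p], so they become disjoint closed sets
    once [p] is removed. They cannot be separated there: every open set [V] that
    contains the other points of [L] has a point of [A] other than [p] in its
    closure.

    To find this point, note that the semigroup has other minimal left ideals,
    and that they accumulate at each point of [L] (lemma [minl_outside]).
    The retraction maps any other minimal left ideal homeomorphically onto [L]
    (lemma [minl_section]). So near each orbit point [n + e] other than [p]
    there is a clopen set [T], included in [V] and disjoint from [L], whose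
    image under the retraction contains a nonempty clopen part of [L] (lemma
    [exists_tile]). A maximal family of such sets [T] with disjoint images
    covers a dense part of [L], and the union [S] of these sets [T], as a set
    of integers, belongs to no point of [L]. Lifting orbit points that converge
    to [p] to points in the closures of the sets [T] and taking a cluster point
    gives a point of the fibre [A] which contains [S], hence is not [p], and
    which is in the closure of [V] (lemma [second_cluster_point]).

    Closed subsets are handled as filters of subsets of the integers. *)

Local Open Scope classical_set_scope.

Local Infix "⊕" := beta_add (at level 50, left associativity).

(** * Addition of ultrafilters *)

Definition shift (n : posnat) (A : set posnat) : set posnat :=
  [set y | A (posnat_add n y)].

(** The form that right translation takes on clopen sets: the preimage of the
    basic clopen set of [A] under [p |-> p + q] is that of [return_times q A]. *)
Definition return_times (q : betaN) (A : set posnat) : set posnat :=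
  [set n | q (shift n A)].

Lemma posnat_addA (x y z : posnat) :
  posnat_add x (posnat_add y z) = posnat_add (posnat_add x y) z.
Proof. by apply: val_inj; rewrite /= addnA. Qed.

Lemma beta_addE (p q : betaN) A : (p ⊕ q) A = p (return_times q A).
Proof. by []. Qed.

Lemma beta_pointE n (A : set posnat) : beta_point n A <-> A n.
Proof. exact: principal_filterP. Qed.

Lemma beta_point_addE n q A : (beta_point n ⊕ q) A <-> return_times q A n.
Proof. exact: principal_filterP. Qed.

Lemma shift_return_times n q A : shift n (return_times q A) = return_times q (shift n A).
Proof.
apply/funext => m; rewrite /shift /return_times /=; congr (ultra_sets q).
by apply/funext => y; rewrite /shift /= posnat_addA.
Qed.

(** Both sides iterate return times, which commute with shifts. *)
Lemma beta_addA (p q r : betaN) : p ⊕ (q ⊕ r) = p ⊕ q ⊕ r.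
Proof.
apply: betaN_ext => A; rewrite !beta_addE.
suff -> : return_times (q ⊕ r) A = return_times q (return_times r A) by [].
apply/funext => n; rewrite -[RHS]/(q (shift n (return_times r A)) : Prop).
by rewrite shift_return_times.
Qed.

Lemma ultra_notin (q : betaN) A : q (~` A) <-> ~ q A.
Proof.
split=> [qCA qA|nqA]; last by have [] := in_ultra_setVsetC A (ultra_setsP q).
have : q (A `&` ~` A) by exact: filterI.
by rewrite setICr => /filter_ex[].
Qed.

(** Ultrafilters are maximal, so one inclusion gives equality. *)
Lemma ultra_sub_eq (p q : betaN) : (forall A, p A -> q A) -> p = q.
Proof.
move=> pq; apply: betaN_ext => A; split=> [|qA]; first exact: pq.
by apply: contrapT => /ultra_notin/pq/ultra_notin.
Qed.

Lemma filter_betaN (F : set_system posnat) :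
  ProperFilter F -> exists q : betaN, forall A, F A -> q A.
Proof.
by move=> /ultraFilterLemma[G [Gu FG]]; exists (BetaN Gu).
Qed.

(** * Cluster points and principal ultrafilters *)

(** The compactness of the space, for sequences: a cluster point at infinity. *)
Lemma seq_cluster (u : nat -> posnat) :
  exists q : betaN, forall A, (exists K, forall k, (K <= k)%N -> A (u k)) -> q A.
Proof.
pose F : set_system posnat := [set A | exists K, forall k, (K <= k)%N -> A (u k)].
suff FF : ProperFilter F by exact: filter_betaN FF.
apply: Build_ProperFilter_ex.
  by move=> A [K HK]; exists (u K); exact: HK.
split; first by exists 0.
- move=> A B [K HK] [K' HK']; exists (maxn K K') => k; rewrite geq_max.
  by move=> /andP[/HK ? /HK'].
- by move=> A B AB [K HK]; exists K => k /HK/AB.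
Qed.

(** Closure under finite intersections, indexed by an initial segment of the
    positive integers, which is empty for [k = 0]. *)
Lemma ultra_finite_forall (q : betaN) (R : posnat -> set posnat) k :
  (forall x, q (R x)) -> q [set y | forall x, (val x <= k)%N -> R x y].
Proof.
move=> qR; elim: k => [|k IH].
  by apply: filterE => y x; rewrite leqNgt (valP x).
have := qR (exist _ k.+1 isT); move: IH; apply: filterS2 => y Ry Rk x.
rewrite leq_eqVlt => /predU1P[xk|]; last exact: Ry.
by have -> : x = exist _ k.+1 isT by exact: val_inj.
Qed.

Lemma ultra_finite_exists (q : betaN) (R : posnat -> set posnat) k :
  q [set y | exists2 x, (val x <= k)%N & R x y] -> exists2 x, (val x <= k)%N & q (R x).
Proof.
move=> qR; apply: contrapT => nR.
pose R' x := [set y | (val x <= k)%N -> ~ R x y].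
have /(ultra_finite_forall q R' k) : forall x, q (R' x).
  move=> x; have [xk|xk] := pselect (val x <= k)%N; last by apply: filterE => y /xk.
  have : q (~` R x) by apply/ultra_notin => Rx; apply: nR; exists x.
  by apply: filterS => y Rx _.
move/(filterI qR) => /filter_ex[y [[x xk Rx] /(_ x xk xk)]].
exact.
Qed.

Definition nonprincipal (q : betaN) := forall n, ~ q [set n].

Lemma nonprincipalP q : Nstar q <-> nonprincipal q.
Proof.
split=> [nq n qn|nq [n _ nq']].
  apply: nq; exists n => //; apply: ultra_sub_eq => A /beta_pointE An.
  by apply: filterS qn => _ ->.
by apply: (nq n); rewrite -nq'; exact/beta_pointE.
Qed.

Lemma nonprincipal_finite q k : nonprincipal q -> q [set y : posnat | (k < val y)%N].
Proof.
move=> nq; have /(ultra_finite_forall q (fun x => ~` [set x]) k) : forall x, q (~` [set x]).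
  by move=> x; apply/ultra_notin/nq.
by apply: filterS => y; apply: contraPP => /negP; rewrite -leqNgt => yk /(_ y yk); apply.
Qed.

Lemma nonprincipal_addl (q r : betaN) : nonprincipal r -> nonprincipal (q ⊕ r).
Proof.
move=> nr n; rewrite beta_addE => /filter_ex[k] /[dup] /filter_ex[y ky] rk.
apply: (nr y); apply: filterS rk => y' /(congr1 val) /= ky'.
apply: val_inj; move: ky' (congr1 val ky) => /=; lia.
Qed.

(** Colour [x] by the parity of [x / n]: adding [n] flips the colour, so [q] and
    [n + q] contain different colour classes. *)
Lemma beta_point_add_neq n q : beta_point n ⊕ q <> q.
Proof.
move=> nq; pose Y : set posnat := [set x | odd (val x %/ val n)].
have flip (x : posnat) : Y (posnat_add n x) <-> ~ Y x.
  rewrite /Y /= divnDl ?dvdnn // divnn (valP n) addnC addn1 /=.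
  by split=> /negP.
have [qY|qY] := in_ultra_setVsetC Y (ultra_setsP q).
- have /ultra_notin : q (~` shift n Y) by apply: filterS qY => x Yx /flip.
  by apply; apply/beta_point_addE; rewrite nq.
- have : q (shift n Y) by apply: filterS qY => x /flip.
  by move/beta_point_addE; rewrite nq; apply/ultra_notin.
Qed.

Lemma beta_point_add m n : beta_point m ⊕ beta_point n = beta_point (posnat_add m n).
Proof. by apply/ultra_sub_eq => A /beta_point_addE/beta_pointE H; exact/beta_pointE. Qed.

Lemma beta_point_add_inj q m n : beta_point m ⊕ q = beta_point n ⊕ q -> m = n.
Proof.
wlog mn : m n / (val m <= val n)%N.
  move=> H mn; have [/H|/ltnW/H nm] := leqP (val m) (val n); first exact.
  by apply/esym/nm.
move: mn; rewrite leq_eqVlt => /predU1P[/val_inj//|mn].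
have dP : (0 < val n - val m)%N by rewrite subn_gt0.
pose d : posnat := @exist nat (fun k => 0 < k)%N (val n - val m)%N dP.
have -> : n = posnat_add d m by apply: val_inj; rewrite /= subnK // ltnW.
by rewrite -beta_point_add -beta_addA => /esym/beta_point_add_neq.
Qed.

(** The image of a closed set under [s |-> s + q] is closed: the points [s] that
    contain a filter [M] form a closed set, and if no basic neighbourhood of [p]
    separates [p] from its image, then [p] is in the image. *)
Lemma beta_divide_in (M : set_system posnat) (p q : betaN) : Filter M ->
  (forall A X, p A -> M X -> exists2 n, X n & return_times q A n) ->
  exists2 s : betaN, M `<=` s & p = s ⊕ q.
Proof.
move=> Mf pq.
pose F : set_system posnat :=
  [set X | exists A Y, [/\ p A, M Y & Y `&` return_times q A `<=` X]].
have FF : ProperFilter F.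
  apply: Build_ProperFilter_ex.
    move=> X [A [Y [pA MY YX]]]; have [n Yn nA] := pq _ _ pA MY.
    by exists n; exact: YX.
  split; first by exists setT, setT; split => //; exact: filterT.
  - move=> X X' [A [Y [pA MY AX]]] [B [Y' [pB MY' BX']]].
    exists (A `&` B), (Y `&` Y'); split; [exact: filterI|exact: filterI|].
    by move=> n [[Yn Y'n] nAB]; split; [apply: AX|apply: BX']; split=> //;
      apply: filterS nAB => y [].
  - move=> X X' XX' [A [Y [pA MY AX]]]; exists A, Y; split=> //.
    exact: subset_trans XX'.
have [s sF] := filter_betaN _ FF; exists s.
  by move=> Y MY; apply: sF; exists setT, Y; split=> //; exact: filterT.
apply: ultra_sub_eq => A pA; rewrite beta_addE; apply: sF.
by exists A, setT; split=> //; exact: filterT.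
Qed.

Lemma beta_divide (p q : betaN) :
  (forall A, p A -> exists n, return_times q A n) -> exists s, p = s ⊕ q.
Proof.
move=> pq; have [|s _ ->] := @beta_divide_in [set setT] p q _; last by exists s.
by move=> A X /pq[n nA] ->; exists n.
Qed.

(** * Minimal left ideals *)

(** [q] lies in a minimal left ideal: from each element [r + q] of the left ideal
    generated by [q] one can return to [q]. *)
Definition minl (q : betaN) : Prop := forall r, exists s, s ⊕ (r ⊕ q) = q.

Lemma minl_addl r q : minl q -> minl (r ⊕ q).
Proof.
move=> mq t; have [s sq] := mq (t ⊕ r).
by exists (r ⊕ s); rewrite -beta_addA (beta_addA t) sq.
Qed.

Lemma minl_addr q r : minl q -> minl (q ⊕ r).
Proof.
by move=> mq t; have [s sq] := mq t; exists s; rewrite (beta_addA t) beta_addA sq.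
Qed.

(** A sum [s + (q + q)] that equals [q] cannot be a positive integer [q]. *)
Lemma minl_nonprincipal q : minl q -> nonprincipal q.
Proof.
move=> mq n qn; have [s sE] := mq q.
move: (qn); rewrite -{1}sE beta_addE => /filter_ex[a].
move=> /(@filter_ex _ q _)[b] qb.
have /filter_ex[_ [-> /(congr1 val) /=]] : q ([set n] `&` shift b (shift a [set n])).
  exact: filterI.
by have := valP a => /=; lia.
Qed.

(** A filter encodes the closed set of ultrafilters containing it; this
    property says that the closed set is a left ideal. Chains of closed sets
    decreasing to an intersection become chains of filters increasing to a
    union, which makes compactness invisible. *)
Definition left_invariant (F : set_system posnat) :=
  forall A, F A -> forall n, F (shift n A).

Lemma chain_filter (C : set (set_system posnat)) :
  C !=set0 -> (forall F, C F -> ProperFilter F) -> total_on C subset ->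
  ProperFilter (\bigcup_(F in C) F).
Proof.
move=> [F0 CF0] CP tot; apply: Build_ProperFilter_ex.
  by move=> A [F /CP ? FA]; exact: filter_ex FA.
split.
- by exists F0 => //; have := CP _ CF0 => ?; exact: filterT.
- move=> A B [F CF FA] [G CG GB].
  have [FG|GF] := tot _ _ CF CG.
    by exists G => //; have ? := CP _ CG; apply: filterI => //; exact: FG.
  by exists F => //; have ? := CP _ CF; apply: filterI => //; exact: GF.
- by move=> A B AB [F CF FA]; exists F => //; have ? := CP _ CF; exact: filterS FA.
Qed.

(** Maximal filters are minimal nonempty closed sets. The empty set of sets is
    added to the family to which Zorn's lemma is applied, as the union of the
    empty chain. *)
Lemma maximal_filter (P : set_system posnat -> Prop) (F0 : set_system posnat) :
  ProperFilter F0 -> P F0 ->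
  (forall C : set (set_system posnat), C !=set0 -> C `<=` [set F | ProperFilter F /\ P F] ->
     total_on C subset -> P (\bigcup_(F in C) F)) ->
  exists M : set_system posnat, [/\ ProperFilter M, P M, F0 `<=` M &
    forall G : set_system posnat, ProperFilter G -> P G -> M `<=` G -> G `<=` M].
Proof.
move=> F0p PF0 Pchain.
pose Q := [set F : set_system posnat | F = set0 \/ [/\ ProperFilter F, P F & F0 `<=` F]].
have [C CQ Ctot|M [QM Mmax]] := @Zorn_bigcup _ Q.
  (* The empty system adds nothing to the union and is not a filter. *)
  pose C' := [set F | C F /\ F !=set0].
  have [[F1 C'F1]|C'0] := pselect (C' !=set0); last first.
    left; rewrite -subset0 => A [F CF FA]; apply: C'0; exists F; split=> //.
    by exists A.
  have -> : \bigcup_(F in C) F = \bigcup_(F in C') F.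
    apply/seteqP; split=> A [F CF FA]; exists F => //; last by case: CF.
    by split => //; exists A.
  have C'P F : C' F -> [/\ ProperFilter F, P F & F0 `<=` F].
    by move=> [/CQ[->|//] [A]].
  have C'tot : total_on C' subset by move=> F G [CF _] [CG _]; exact: Ctot.
  right; split.
  - by apply: chain_filter => //; [exists F1|move=> F /C'P[]].
  - by apply: Pchain => //; [exists F1|move=> F /C'P[]].
  - by move=> A F0A; exists F1 => //; have [_ _] := C'P _ C'F1; exact.
have [M0|[Mp PM FM]] := QM.
  exfalso; apply: (Mmax F0); last by right; split.
  rewrite M0; split; first exact: sub0set.
  by move=> /(_ setT); apply; exact: filterT.
exists M; split=> // G Gp PG MG; apply: contrapT => GM.
apply: (Mmax G) => //; right; split => //; exact: subset_trans MG.
Qed.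

(** The filter of the left ideal generated by [q], which is the closure of the
    orbit [n + q]. *)
Definition orbit_filter (q : betaN) : set_system posnat :=
  [set A | forall n, return_times q A n].

Lemma orbit_filter_proper q : ProperFilter (orbit_filter q).
Proof.
apply: Build_ProperFilter_ex.
  move=> A /(_ (exist _ 1 isT)) /filter_ex[y Ay]; by eexists; exact: Ay.
split.
- by move=> n; exact: filterT.
- by move=> A B qA qB n; apply: filterI; [exact: qA|exact: qB].
- by move=> A B AB qA n; apply: filterS (qA n) => y; exact: AB.
Qed.

Lemma orbit_filter_sub q r A : orbit_filter q A -> (r ⊕ q) A.
Proof. by move=> qA; rewrite beta_addE; apply: (@filterE _ r) => n; exact: qA. Qed.

Lemma orbit_filterP (q x : betaN) :
  (forall A, orbit_filter q A -> x A) -> exists s, x = s ⊕ q.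
Proof.
move=> xq; apply: beta_divide => A xA; apply: contrapT => nA.
suff /xq/ultra_notin : orbit_filter q (~` A) by [].
by move=> n; apply/ultra_notin => An; apply: nA; exists n.
Qed.

Lemma orbit_filter_invariant q : left_invariant (orbit_filter q).
Proof.
by move=> A qA n m; rewrite -shift_return_times /shift; exact: qA.
Qed.

(** A maximal invariant filter above the filter of the left ideal of [q] is the
    filter of a minimal left ideal inside it. *)
Lemma exists_minl q : exists r, minl (r ⊕ q).
Proof.
have [|M [Mp Minv qM Mmax]] := maximal_filter left_invariant (orbit_filter q)
  (orbit_filter_proper q) (@orbit_filter_invariant q).
  by move=> C _ CP tot A [F CF FA] n; exists F => //; apply: (CP _ CF).2.
have [z zM] := filter_betaN _ Mp.
have [r zE] : exists r, z = r ⊕ q by apply: orbit_filterP => A /qM/zM.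
exists r; rewrite -zE => t.
have [|s sz] := orbit_filterP (t ⊕ z) z; last by exists s.
move=> A tzA; apply: (zM); apply: (Mmax (orbit_filter (t ⊕ z))) => //.
- exact: orbit_filter_proper.
- exact: orbit_filter_invariant.
- move=> B MB n; apply: (@filterE _ t) => m.
  by apply: zM; apply/Minv/Minv.
Qed.

(** The elements of minimal left ideals form a two-sided ideal, which therefore
    contains the smallest one. *)
Lemma K_minl p : K_betaN p -> minl p.
Proof.
apply; split=> //; split.
  by have [r m] := exists_minl (beta_point (exist _ 1 isT)); eexists; exact: m.
by move=> a b ma; split; [exact: minl_addr|exact: minl_addl].
Qed.

(** * Idempotents *)

(** The closed set of ultrafilters containing [F] is a subsemigroup. *)
Definition semigroup_filter (F : set_system posnat) :=
  forall q r : betaN, (F `<=` q) -> (F `<=` r) -> F `<=` (q ⊕ r).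

Definition common_sets (Q : set betaN) : set_system posnat :=
  [set A | forall q, Q q -> q A].

Lemma common_sets_filter Q : Q !=set0 -> ProperFilter (common_sets Q).
Proof.
move=> [q Qq]; apply: Build_ProperFilter_ex.
  by move=> A /(_ _ Qq) /filter_ex.
split.
- by move=> r _; exact: filterT.
- by move=> A B QA QB r Qr; apply: filterI; [exact: QA|exact: QB].
- by move=> A B AB QA r /QA; exact: filterS.
Qed.

(** The Ellis-Numakura lemma. Let [M] be the filter of a minimal closed
    subsemigroup and [x] a point of it. Right translation by [x] maps this
    semigroup to a closed subsemigroup of itself, hence onto it, so [q + x = x]
    has a solution [q]. The solutions form a closed subsemigroup, so they fill
    it and [x] itself is one of them. *)
Lemma ellis (F : set_system posnat) : ProperFilter F -> semigroup_filter F ->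
  exists2 e : betaN, F `<=` e & e ⊕ e = e.
Proof.
move=> Fp Fs.
have [|M [Mp Ms FM Mmax]] := maximal_filter semigroup_filter F Fp Fs.
  move=> C _ CP tot q r Cq Cr A [G CG GA].
  apply: ((CP _ CG).2 q r) => // B GB; [apply: Cq|apply: Cr]; by exists G.
have [x xM] := filter_betaN _ Mp.
exists x; first exact: subset_trans xM.
(* The translate of the semigroup by [x] is all of it, in particular contains [x]. *)
have [q Mq xq] : exists2 q : betaN, M `<=` q & x = q ⊕ x.
  pose Mx := [set y | exists2 q : betaN, M `<=` q & y = q ⊕ x].
  have in_Mx (y : betaN) : common_sets Mx `<=` y -> Mx y.
    move=> Gy; apply: beta_divide_in => A X yA MX; apply: contrapT => XA.
    suff /Gy/ultra_notin : common_sets Mx (~` A) by [].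
    move=> _ [q Mq ->]; rewrite beta_addE; apply: filterS (Mq _ MX) => n Xn.
    by apply/ultra_notin => nA; apply: XA; exists n.
  apply: (in_Mx) => A GA; apply: (xM); move: A GA; apply: Mmax.
  - by apply: common_sets_filter; exists (x ⊕ x), x.
  - move=> _ _ /in_Mx[q Mq ->] /in_Mx[r Mr ->] A; apply.
    exists (q ⊕ x ⊕ r); last by rewrite !beta_addA.
    by apply: (Ms) => //; apply: (Ms).
  - by move=> A MA _ [q Mq ->]; exact: Ms MA.
pose H := [set q : betaN | M `<=` q /\ q ⊕ x = x].
have in_H (y : betaN) : common_sets H `<=` y -> H y.
  move=> Hy; split; first by move=> A MA; apply: Hy => r [+ _]; exact.
  apply/esym/ultra_sub_eq => A xA; rewrite beta_addE; apply: Hy => r [_ rx].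
  by rewrite -beta_addE rx.
suff /in_H[] : common_sets H `<=` x by [].
move=> A HA; apply: (xM); move: A HA; apply: Mmax.
- by apply: common_sets_filter; exists q.
- move=> a b /in_H[Ma ax] /in_H[Mb bx] A; apply; split; first exact: Ms.
  by rewrite -beta_addA bx.
- by move=> A MA r [+ _]; exact.
Qed.

(** An idempotent [e] of the minimal left ideal of [p] is a right identity on it,
    since every element of that ideal has the form [s + e]. *)
Lemma minl_idempotent p : minl p ->
  exists e, [/\ e ⊕ e = e, minl e & p ⊕ e = p].
Proof.
move=> mp.
have [||e Fe ee] := ellis (orbit_filter p).
- exact: orbit_filter_proper.
- by move=> q r _ /orbit_filterP[s ->] A pA; rewrite beta_addA; exact: orbit_filter_sub.
have [s es] := orbit_filterP p e Fe.
exists e; split=> //; first by rewrite es; exact: minl_addl.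
by have [t] := mp s; rewrite -es => <-; rewrite -beta_addA ee.
Qed.

(** * Other minimal left ideals close to a given one *)

(** If arbitrarily large bounds [N] failed at points [u N], a cluster point [r] of
    these points would generate a sum [r + e] with no translate containing [B],
    although some [s + (r + e)] equals [e]. *)
Lemma minl_syndetic (e : betaN) B : minl e -> e B ->
  exists N, forall x, exists2 n : posnat, (val n <= N)%N & return_times e (shift n B) x.
Proof.
move=> me eB; apply: contrapT => nN.
have /choice[u uN] : forall N, exists x, forall n : posnat, (val n <= N)%N ->
    ~ return_times e (shift n B) x.
  move=> N; apply: contrapT => nx; apply: nN; exists N => x.
  by apply: contrapT => nn; apply: nx; exists x => n nN Bn; apply: nn; exists n.
have [r ru] := seq_cluster u.
have [s sE] := me r; move: eB; rewrite -{1}sE beta_addE.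
move=> /filter_ex[n]; apply/ultra_notin; rewrite beta_addE.
apply: ru; exists (val n) => k nk.
by apply/ultra_notin; exact: uN.
Qed.

(** Piecewise syndeticity of [B] means that for some [N] and all [k] such
    intervals exist arbitrarily far away. *)
Definition window N B (k : nat) : set posnat :=
  [set y | forall x, (val x <= k)%N ->
     exists2 n : posnat, (val n <= N)%N & shift n B (posnat_add x y)].

(** Members of [e] are piecewise syndetic: intersect finitely many members of [e]
    supplied by the syndetic return times. *)
Lemma minl_window (e : betaN) B : minl e -> e B ->
  exists N, forall k M, exists2 y : posnat, (M < val y)%N & window N B k y.
Proof.
move=> me /(minl_syndetic _ _ me)[N HN]; exists N => k M.
suff ek : e (window N B k).
  have /filter_ex[y [My yk]] : e ([set y : posnat | (M < val y)%N] `&` window N B k).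
    by apply: filterI => //; exact/nonprincipal_finite/minl_nonprincipal.
  by exists y.
apply: (ultra_finite_forall e (fun x y =>
  exists2 n : posnat, (val n <= N)%N & shift n B (posnat_add x y))) => x.
by have [n nN] := HN x; apply: filterS => y xy; exists n.
Qed.

(** Windows placed one after the other, so that those of even index and those of
    odd index cover disjoint sets. *)
Lemma window_seq N B : (forall k M, exists2 y : posnat, (M < val y)%N & window N B k y) ->
  exists y : nat -> posnat, (forall k, window N B k (y k)) /\
    forall j k, (j < k)%N -> (val (y j) + j < val (y k))%N.
Proof.
move=> HN.
have /choice[f fP] : forall kM : nat * nat,
    exists y : posnat, (kM.2 < val y)%N /\ window N B kM.1 y.
  by move=> [k M]; have [y ? ?] := HN k M; exists y.
pose fix y k := if k is k'.+1 then f (k, val (y k') + k')%N else f (0, 0).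
have yS k : (val (y k) + k < val (y k.+1))%N by have [] := fP (k.+1, val (y k) + k)%N.
exists y; split.
  by case=> [|k]; [have [] := fP (0, 0)|have [] := fP (k.+1, val (y k) + k)%N].
move=> j k; elim: k => // k IH; rewrite ltnS leq_eqVlt => /predU1P[->//|/IH].
by have := yS k; lia.
Qed.

(** No minimal left ideal is relatively open in the union of all of them: each
    neighbourhood of [e] meets another one. The windows of even index and those
    of odd index give two disjoint thick sets; each contains a left ideal in
    its closure, so one of these ideals contains a minimal left ideal that
    misses [e]. Every point of its thick set enters [B] after one of finitely
    many translations, and translating by the right one stays in the ideal. *)
Lemma minl_outside (e : betaN) B : minl e -> e B ->
  exists z, [/\ minl z, z B & forall s, z <> s ⊕ e].
Proof.
move=> me eB; have [N /window_seq[y [yw ymono]]] := minl_window e B me eB.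
pose T (b : bool) : set posnat :=
  [set w | exists k x, (val x <= k.*2 + b)%N /\ w = posnat_add x (y (k.*2 + b))].
have Tdisj w : T true w -> T false w -> False.
  move=> [k [x [xk ->]]] [l [x' [x'l /(congr1 val) /=]]].
  move: (valP x) (valP x') xk x'l => /= x0 x'0 xk x'l.
  by have [/ymono/=|/ymono/=|] := ltngtP (k.*2 + true)%N (l.*2 + false)%N; lia.
have Tz b : exists z, [/\ minl z, z (T b) & forall s : betaN, (s ⊕ z) (T b)].
  have [q qy] := seq_cluster (fun k => y (k.*2 + b)%N).
  have qT t : (t ⊕ q) (T b).
    rewrite beta_addE; apply: (@filterE _ t) => x.
    apply: qy; exists (val x) => k xk; exists k, x; split=> //; lia.
  have [r rq] := exists_minl q; exists (r ⊕ q); split=> // s.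
  by rewrite beta_addA.
have [b [z [mz ze zT]]] : exists b z, [/\ minl z, forall s, z <> s ⊕ e & z (T b)].
  apply: contrapT => nz.
  have in_ideal b z : minl z -> z (T b) -> exists s, z = s ⊕ e.
    move=> mz zT; apply: contrapT => ze; apply: nz; exists b, z.
    by split=> // s zs; apply: ze; exists s.
  have [z0 [mz0 z0T z0L]] := Tz true; have [z1 [mz1 z1T _]] := Tz false.
  have [s0 z0E] := in_ideal _ _ mz0 z0T; have [s1 z1E] := in_ideal _ _ mz1 z1T.
  have [t tE] := me s0.
  have := z0L (s1 ⊕ t); rewrite z0E -beta_addA tE -z1E => z1T'.
  by have /filter_ex[w [/Tdisj]] : z1 (T true `&` T false) by exact: filterI.
have [n _ zB] : exists2 n, (val n <= N)%N & z (shift n B).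
  apply: ultra_finite_exists; apply: filterS zT => w [k [x [xk ->]]].
  exact: yw.
exists (beta_point n ⊕ z); split.
- exact: minl_addl.
- exact/beta_point_addE.
- move=> s nzE; have [t tE] := mz (beta_point n); apply: (ze (t ⊕ s)).
  by rewrite -beta_addA -nzE tE.
Qed.

(** * A second cluster point in the fibre of the retraction *)

Section SecondClusterPoint.
Variables e p : betaN.
Hypotheses (ee : e ⊕ e = e) (me : minl e) (mp : minl p) (pe : p ⊕ e = p).

Lemma return_times_idem A : return_times e (return_times e A) = return_times e A.
Proof.
apply/funext => n; rewrite -[LHS]/(e (shift n (return_times e A)) : Prop).
by rewrite shift_return_times -beta_addE ee.
Qed.

(** On the left ideal of [e], taking return times does not change a clopen set,
    because [q |-> q + e] fixes that ideal pointwise. *)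
Lemma return_times_fixed {q : betaN} {A} : q ⊕ e = q -> q (return_times e A) <-> q A.
Proof. by move=> qe; rewrite -{2}qe. Qed.

Lemma return_timesS {A B} : A `<=` B -> return_times e A `<=` return_times e B.
Proof. by move=> AB n; apply: filterS => y; exact: AB. Qed.

(** [Z] stands for a clopen part of the left ideal [L] of the points fixed by
    [q |-> q + e]; it is normalised to be its own set of return times, so that
    disjointness in [L] is disjointness of subsets of the integers. The closure
    of [T] misses [L] and nevertheless contains a preimage of each orbit point
    of that part of [L]. *)
Record tile (good : set (set posnat)) (T Z : set posnat) : Prop := Tile {
  tile_good : good T;
  tile_fixed : return_times e Z = Z;
  tile_sub : T `<=` Z;
  tile_null : forall q, q ⊕ e = q -> ~ q T;
  tile_lift : forall m, Z m ->
    exists v, [/\ nonprincipal v, v T & v ⊕ e = beta_point m ⊕ e] }.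

(** Right translation by [e] restricts to a bijection from the minimal left ideal
    of [z] to that of [e]; its inverse is right translation by an element [g]
    of the former. The element [s + z] with [s + z + e = e] only needs to be
    multiplied by [e] on the left in order to absorb [e] as well. *)
Lemma minl_section {z} : minl z ->
  exists g, [/\ nonprincipal g, g ⊕ e = e & z ⊕ e ⊕ g = z].
Proof.
move=> mz; have [s sE] := me z; have [t] := mz (e ⊕ s).
set g := e ⊕ s ⊕ z => tg.
have ge : g ⊕ e = e by rewrite /g -!beta_addA sE.
have eg : e ⊕ g = g by rewrite /g !beta_addA ee.
exists g; split => //.
- apply/nonprincipalP => -[m _ gm]; apply: (@beta_point_add_neq m e).
  by rewrite gm ge.
- by rewrite -{1}tg -(beta_addA t) ge -beta_addA eg.
Qed.

Arguments tile_good {good T Z}.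
Arguments tile_sub {good T Z}.
Arguments tile_lift {good T Z} _ {m}.

(* [good] stands for the sets whose closure lies in a given open set around
   the points of the ideal of [e] other than [p]. *)
Variable good : set (set posnat).
Hypothesis goodS : forall {A B}, A `<=` B -> good B -> good A.
Hypothesis good_orbit : forall {n}, beta_point n ⊕ e <> p ->
  exists2 B, good B & (beta_point n ⊕ e) B.

(** Near [n + e], inside a good set, there is a point [z] of another minimal left
    ideal, hence a good clopen neighbourhood [T] of [z] that misses [L]. As
    [q |-> q + g] inverts the retraction on the ideal of [z], the points of [L]
    that it sends into [T] form a nonempty clopen set, all of which lifts to
    [T]. *)
Lemma exists_tile {n Y} : beta_point n ⊕ e <> p -> (beta_point n ⊕ e) Y ->
  exists T Z, [/\ tile good T Z, Z !=set0 & Z `<=` return_times e Y].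
Proof.
move=> /good_orbit[B gB nB] nY; set d := beta_point n ⊕ e in nB nY *.
have de : d ⊕ e = d by rewrite /d -beta_addA ee.
have [z [mz [zB zY] zd]] : exists z, [/\ minl z, z B /\ z (return_times e Y) & z ⊕ e <> z].
  have [|z [mz zBY zd]] := @minl_outside d (B `&` return_times e Y) (minl_addl _ _ me).
    apply: (@filterI _ d _ _ _ nB); exact/(return_times_fixed de).
  exists z; split=> //; first by split; apply: filterS zBY => x [].
  have [t tE] := me (beta_point n).
  by move=> ze; apply: (zd (z ⊕ t)); rewrite -beta_addA tE.
have [D zD zeD] : exists2 D, z D & ~ (z ⊕ e) D.
  apply: contrapT => nD; apply: zd; apply/esym/ultra_sub_eq => D zD.
  by apply: contrapT => zeD; apply: nD; exists D.
have [g [ng ge zg]] := minl_section mz.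
(* A point fixed by the retraction cannot contain [D] without [return_times e D]. *)
pose T := B `&` (D `&` ~` return_times e D).
have zT : z T by do 2?[apply: filterI => //]; apply/ultra_notin.
pose Z := return_times e (return_times g T `&` Y).
exists (T `&` Z), Z; split; last by apply: return_timesS => x [].
- split.
  + by apply: goodS gB => x [[]].
  + exact: return_times_idem.
  + by move=> x [].
  + move=> q qe qT; have qD : q D by apply: filterS qT => x [[_ []]].
    have /ultra_notin : q (~` return_times e D) by apply: filterS qT => x [[_ []]].
    by apply; exact/(return_times_fixed qe).
  + move=> m Zm; pose v := beta_point m ⊕ e ⊕ g.
    have ve : v ⊕ e = beta_point m ⊕ e by rewrite /v -!beta_addA ge ee.
    exists v; split=> //; first exact: nonprincipal_addl.
    have mTY : (beta_point m ⊕ e) (return_times g T `&` Y) by apply/beta_point_addE.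
    have vT : v T.
      rewrite /v beta_addE.
      by apply: (@filterS _ (beta_point m ⊕ e) _ _ _ _ mTY) => x [].
    have vZ : v Z by rewrite -ve in mTY.
    exact: (@filterI _ v).
- apply: (@filter_ex _ z _); apply: (@filterI _ (z ⊕ e)) => //.
  by have : (z ⊕ e ⊕ g) T by rewrite zg.
Qed.

(** The point [p] is not isolated in [L]: a clopen neighbourhood contains
    infinitely many orbit points, and these are distinct. *)
Lemma orbit_point_neq {Y} : p Y -> exists2 n, beta_point n ⊕ e <> p & (beta_point n ⊕ e) Y.
Proof.
rewrite -{1}pe beta_addE => pY; apply: contrapT => nY.
(* Otherwise the orbit points in this neighbourhood all coincide with [p]. *)
have only n : return_times e Y n -> beta_point n ⊕ e = p.
  by move=> Yn; apply: contrapT => np; apply: nY; exists n => //; apply/beta_point_addE.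
have [n Yn] := filter_ex pY.
apply: (minl_nonprincipal p mp n); apply: filterS pY => m Ym.
by apply: (@beta_point_add_inj e); rewrite !only.
Qed.

(** Take a maximal disjoint family of tiles and the union [S] of their sets [T].
    By maximality the orbit points in the family are dense in [L]. None of them
    has [S] as a member, because in a tile [S] reduces to [T]; hence no point of
    [L] does, and in particular not [p]. On the other hand [p] is a limit of
    orbit points in the family, whose lifts contain [S]; a cluster point [x] of
    these lifts still lies over [p] and contains [S], so it differs from [p]. *)
Lemma second_cluster_point : exists x, [/\ nonprincipal x, x ⊕ e = p, x <> p &
  forall C, x C -> exists T (v : betaN), [/\ good T, v T, v C, nonprincipal v & v <> p]].
Proof.
pose D := [set TZ : set posnat * set posnat | tile good TZ.1 TZ.2].
have [E [ED Etriv Emax]] := ex_maximal_disjoint_subcollection (@snd _ (set posnat)) D.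
have meet Y : p Y -> exists TZ (v : betaN), [/\ E TZ, nonprincipal v, v TZ.1 & (v ⊕ e) Y].
  move=> pY; have [n np nY] := orbit_point_neq pY.
  have [T [Z [TZ [k Zk] ZY]]] := exists_tile np nY.
  have [TZ' ETZ' [m [Z'm Zm]]] : exists2 TZ', E TZ' & TZ'.2 `&` Z !=set0.
    apply: contrapT => disj.
    apply: (Emax (E `|` [set (T, Z)])).
    - split; first by move=> ?; left.
      by move=> /(_ (T, Z)) H; apply: disj; exists (T, Z); [apply: H; right|exists k].
    - by move=> i [/ED//|->].
    - move=> i j [Ei|iE] [Ej|jE] ij.
      + exact: Etriv.
      + by exfalso; apply: disj; exists i; rewrite // jE in ij.
      + by exfalso; apply: disj; exists j; rewrite // setIC iE in ij *.
      + by rewrite iE jE.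
  have [v [nv vT ve]] := tile_lift (ED _ ETZ') Z'm.
  exists TZ', v; split=> //; rewrite ve; apply/beta_point_addE; exact: ZY.
pose S := \bigcup_(TZ in E) TZ.1.
have pS : ~ p S.
  move=> /meet[TZ [v [ETZ nv vT veS]]].
  have [_ Zfix TZsub Tnull _] := ED _ ETZ.
  have ve : v ⊕ e ⊕ e = v ⊕ e by rewrite -beta_addA ee.
  apply: (Tnull _ ve).
  have veZ : (v ⊕ e) TZ.2 by rewrite beta_addE Zfix; apply: filterS vT.
  apply: filterS2 veS veZ => x [TZ' ETZ' xT'] xZ.
  suff <- : TZ' = TZ by [].
  by apply: Etriv => //; exists x; split=> //; apply: (tile_sub (ED _ ETZ')).
pose lifts Y := [set v | [/\ nonprincipal v, exists2 TZ, E TZ & v TZ.1 & (v ⊕ e) Y]].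
(* A point containing [F] is a cluster point of the lifts as [Y] shrinks to [p]. *)
pose F : set_system posnat := [set A | exists2 Y, p Y & forall v, lifts Y v -> v A].
have FF : ProperFilter F.
  apply: Build_ProperFilter_ex.
    move=> A [Y /meet[TZ [v [ETZ nv vT vY]]]] /(_ v) H.
    by apply: (@filter_ex _ v _); apply: H; split=> //; exists TZ.
  split.
  - by exists setT => [|v _]; exact: filterT.
  - move=> A B [Y pY YA] [Y' pY' YB]; exists (Y `&` Y'); first exact: filterI.
    move=> v [nv vT vY]; apply: filterI; [apply: YA|apply: YB]; split=> //;
      by apply: filterS vY => x [].
  - by move=> A B AB [Y pY YA]; exists Y => // v /YA; exact: filterS.
have [x xF] := filter_betaN _ FF.
have xlifts C Y : x C -> p Y -> exists2 v, lifts Y v & v C.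
  move=> xC pY; apply: contrapT => nv.
  suff /xF/ultra_notin : F (~` C) by [].
  by exists Y => // v vY; apply/ultra_notin => vC; apply: nv; exists v.
exists x; split.
- by move=> n /xlifts/(_ (@filterT _ p _))[v [nv _ _] /nv].
- by apply/esym/ultra_sub_eq => Y pY; rewrite beta_addE; apply: xF; exists Y => // v [].
- move=> xp; apply: pS; rewrite -xp; apply: xF; exists setT; first exact: filterT.
  by move=> v [_ [TZ ETZ]] + _; apply: filterS => y Ty; exists TZ.
- move=> C /xlifts/(_ (@filterT _ p _))[v [nv [TZ ETZ vT] _] vC].
  exists TZ.1, v; split=> //; first exact: tile_good (ED _ ETZ).
  by move=> vp; apply: pS; rewrite -vp; apply: filterS vT => y Ty; exists TZ.
Qed.

End SecondClusterPoint.

(** * Normality *)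

Lemma nbhs_betaN (q : betaN) (U : set betaN) :
  nbhs q U <-> exists2 B, q B & beta_bar B `<=` U.
Proof.
rewrite nbhsE; split=> [[_ [[D _ <-] [B DB qB] DU]]|[B qB BU]].
  by exists B => // r rB; apply: DU; exists B.
exists (beta_bar B) => //; split=> //.
by exists [set B] => //; rewrite bigcup_set1.
Qed.

(** Neighbourhoods in a subspace, in terms of members of the ultrafilter. *)
Lemma nbhs_subbetaN (A : set betaN) (x : A) (U : set A) :
  nbhs x U <-> exists2 B, set_val x B & forall y : A, set_val y B -> U y.
Proof.
split=> [|[B xB BU]].
  rewrite nbhsE => -[_ [[W oW <-] Wx WU]].
  have /nbhs_betaN[B xB BW] : nbhs (set_val x) W by exact: open_nbhs_nbhs.
  by exists B => // y yB; apply: WU; apply: BW.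
have xbar : nbhs (set_val x) (beta_bar B) by apply/nbhs_betaN; exists B.
have : nbhs x (@set_val _ A @^-1` beta_bar B).
  exact: (@initial_continuous A betaN set_val x _ xbar).
by apply: filterS => y /BU.
Qed.

Theorem corollary3p12 (p : betaN) (hp : K_betaN p) :
  ~ normal_space (set_type (Nstar `\ p)).
Proof.
have mp := K_minl p hp.
have [e [ee me pe]] := minl_idempotent p mp.
set X := set_type (Nstar `\ p) => normX.
pose L : set X := [set x | set_val x ⊕ e = set_val x].
pose A : set X := [set x | set_val x ⊕ e = p].
have Xp (x : X) : set_val x <> p by have [_] := set_mem (valP x).
have closedL : closed L.
  move=> x xL; apply/esym/ultra_sub_eq => D xD.
  apply: contrapT => /ultra_notin xeD.
  have /xL[y [yL [yD yeD]]] :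
      nbhs x [set y : X | set_val y D /\ set_val y (return_times e (~` D))].
    apply/nbhs_subbetaN; exists (D `&` return_times e (~` D)); first exact: filterI.
    by move=> y yD; split; apply: filterS yD => n [].
  (* Membership in a sum is membership of the return times. *)
  have : (set_val y ⊕ e) (~` D) by [].
  by rewrite yL => /ultra_notin.
have closedA : closed A.
  move=> x xA; apply/esym/ultra_sub_eq => D pD.
  apply: contrapT => /ultra_notin xeD.
  have /xA[y [yA yeD]] : nbhs x [set y : X | (set_val y ⊕ e) (~` D)].
    by apply/nbhs_subbetaN; exists (return_times e (~` D)).
  have : (set_val y ⊕ e) (~` D) by [].
  by rewrite yA => /ultra_notin.
have [|V LV VA] := normX L closedL (~` A).
  apply/set_nbhsP; exists (~` A); split=> //; first exact: closed_openC.
  by move=> x xL xA; apply: (Xp x); rewrite -xL -[RHS]xA.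
(* Sets whose clopen trace on the subspace is included in [V]. *)
pose good := [set B | forall y : X, set_val y B -> V y].
have goodS B C : B `<=` C -> good C -> good B.
  by move=> BC gC y yB; apply: gC; apply: filterS yB.
have in_X (q : betaN) : nonprincipal q -> q <> p -> exists x : X, set_val x = q.
  move=> nq qp; have Xq : q \in Nstar `\ p by rewrite inE; split=> //; exact/nonprincipalP.
  by exists (exist _ q Xq).
have good_orbit n : beta_point n ⊕ e <> p -> exists2 B, good B & (beta_point n ⊕ e) B.
  move=> np; have [x xE] : exists x : X, set_val x = beta_point n ⊕ e.
    by apply: in_X => //; exact/minl_nonprincipal/minl_addl.
  have /nbhs_subbetaN[B xB BV] : nbhs x V by apply: LV; rewrite /L /= xE -beta_addA ee.
  by exists B; rewrite -?xE.
have [x [nx xe xp xV]] := second_cluster_point _ _ ee me mp pe good goodS good_orbit.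
have [y yE] := in_X x nx xp.
apply: (VA y); last by rewrite /A /= yE.
move=> U /nbhs_subbetaN[C]; rewrite yE => /xV[T [v [gT vT vC nv vp]]] CU.
have [w wE] := in_X v nv vp.
by exists w; split; [apply: gT|apply: CU]; rewrite wE.
Qed.
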